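(* Consider a first-order ODE $u'=\phi(x,u)$ whose associated curvature $\mathcal{K}(x,u)=-(\phi_{xu}+\phi_u^2+\phi\,\phi_{uu})(x,u)$ satisfies $\mathcal{K}(x,u)=\kappa(x)$, and let $L=\frac{d^2}{dx^2}+\kappa(x)$. Assume $\kappa$ belongs to a differential field $F$ with algebraically closed constant field $\mathcal{C}$. (a) If $L(y)=0$ admits a non-zero Liouvillian solution over $F$, then the first-order ODE $u'=\phi(x,u)$ is integrable by quadratures. (b) Conversely, if two distinct solutions of the first-order ODE $u'=\phi(x,u)$ belong to a (common) Liouvillian extension of $F$, then $L(y)=0$ admits a non-zero Liouvillian solution. In particular, when $\kappa\in\mathbb{C}(x)$, Kovacic's algorithm applied to $L(y)=0$ decides the Liouvillian integrability of the nonlinear first-order ODE $u'=\phi(x,u)$.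
   Context: The function $\phi$ is sufficiently smooth on an open set $D\subset\mathbb{R}^2$ whose fibers $D_x=\{u\in\mathbb{R}:(x,u)\in D\}$ are connected; subscripts denote partial derivatives; all assertions are local ($D$ and intervals of definition may be shrunk). The condition $\mathcal{K}(x,u)=\kappa(x)$ says that $\mathcal K$ depends only on $x$. The derivation of $F$ is $d/dx$. A Liouvillian extension of $F$ is a differential field extension $E\supset F$ obtained by a finite tower of intermediate extensions, each adjoining to the preceding field $F_i$ either an integral (an element $a$ with $a'\in F_i$), an exponential of an integral (an element $a$ with $a'/a\in F_i$), or an element algebraic over $F_i$. A Liouvillian solution (over $F$) is a solution lying in a Liouvillian extension of $F$. Integrable by quadratures has its usual meaning: the general solution can be obtained, locally, by finitely many algebraic operations, differentiations, compositions, integrations and inversions of functions, starting from the known data (here $\phi$ and a Liouvillian solution of $L(y)=0$); concretely, an integrating factor of the ODE can be constructed from these data, and a first integral is then found by integration. $\mathbb{C}(x)$ is the field of rational functions with complex coefficients. Kovacic's algorithm is the procedure which, given $\kappa\in\mathbb{C}(x)$, determines in finitely many steps whether $y''+\kappa(x)y=0$ admits a non-zero Liouvillian solution over $\mathbb{C}(x)$, and computes one explicitly when it does. ''Decides the Liouvillian integrability'' means: if the algorithm finds a non-zero Liouvillian solution, then the first-order ODE is integrable by quadratures; if the algorithm shows there is none, then no two distinct solutions of the first-order ODE belong to a Liouvillian extension of $\mathbb{C}(x)$. *)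

(* Defs.v *)
(* Stdlib reals with Coquelicot. *)
From Stdlib Require Import Reals List.
From Coquelicot Require Import Coquelicot.
Open Scope R_scope.

(** * Intervals and generic equality *)

Definition is_open_interval (J : R -> Prop) : Prop :=
  open J /\ is_connected J /\ exists x, J x.

Definition sub_interval (J I : R -> Prop) : Prop :=
  is_open_interval J /\ forall x, J x -> I x.

(* [P] holds on a dense open subset of [J]: every point of [J] is in the closure
   of the interior of [P].  Elements of function fields have singularities (poles,
   branch points), so they are only compared, and only differentiated, generically;
   in this way C(x) is a field of functions on every interval. *)
Definition generic (J : R -> Prop) (P : R -> Prop) : Prop :=
  forall x, J x -> forall V : R -> Prop, locally x V ->
    exists z, J z /\ V z /\ locally z P.

Definition gen_eq (J : R -> Prop) (f g : R -> C) : Prop :=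
  generic J (fun x => f x = g x).

Definition gen_zero (J : R -> Prop) (f : R -> C) : Prop :=
  gen_eq J f (fun _ => RtoC 0).

Definition gen_deriv (J : R -> Prop) (f g : R -> C) : Prop :=
  generic J (fun x => is_derive f x (g x)).

(** * Differential fields of complex-valued functions, with derivation d/dx *)

(* Coefficients are listed by increasing degree. *)
Definition poly_eval (l : list C) (z : C) : C :=
  fold_right (fun a s => Cplus a (Cmult z s)) (RtoC 0) l.

Definition fpoly_eval (l : list (R -> C)) (f : R -> C) : R -> C :=
  fun x => poly_eval (map (fun c => c x) l) (f x).

Record diff_field (J : R -> Prop) (F : (R -> C) -> Prop) : Prop := {
  df_eq : forall f g, F f -> gen_eq J f g -> F g;
  df_one : F (fun _ => RtoC 1);
  df_sub : forall f g, F f -> F g -> F (fun x => Cminus (f x) (g x));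
  df_mul : forall f g, F f -> F g -> F (fun x => Cmult (f x) (g x));
  df_inv : forall f, F f -> ~ gen_zero J f ->
    generic J (fun x => f x <> RtoC 0) /\ F (fun x => Cinv (f x));
  df_der : forall f, F f -> exists g, F g /\ gen_deriv J f g
}.

Definition constant_of (J : R -> Prop) (F : (R -> C) -> Prop) (c : R -> C) : Prop :=
  F c /\ gen_deriv J c (fun _ => RtoC 0).

Definition alg_closed_constants (J : R -> Prop) (F : (R -> C) -> Prop) : Prop :=
  forall l : list (R -> C),
    List.Forall (constant_of J F) l ->
    List.Exists (fun c => ~ gen_zero J c) (tl l) ->
    exists z, constant_of J F z /\ gen_zero J (fpoly_eval l z).

(* The field obtained by restricting the elements of [F] to [J]. *)
Definition restrict (J : R -> Prop) (F : (R -> C) -> Prop) : (R -> C) -> Prop :=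
  fun f => exists g, F g /\ gen_eq J g f.

(* C(x), as a field of functions on R. *)
Definition ratfun (p q : list C) : R -> C :=
  fun x => Cdiv (poly_eval p (RtoC x)) (poly_eval q (RtoC x)).

Definition nonzero_poly (q : list C) : Prop := List.Exists (fun a => a <> RtoC 0) q.

Definition Cx : (R -> C) -> Prop :=
  fun f => exists p q, nonzero_poly q /\ gen_eq (fun _ => True) (ratfun p q) f.

(** * Liouvillian extensions *)

Definition adjoin (J : R -> Prop) (F : (R -> C) -> Prop) (a : R -> C)
    (E : (R -> C) -> Prop) : Prop :=
  diff_field J E /\ (forall f, F f -> E f) /\ E a /\
  forall K, diff_field J K -> (forall f, F f -> K f) -> K a ->
    forall f, E f -> K f.

Definition integral_over (J : R -> Prop) (F : (R -> C) -> Prop) (a : R -> C) : Prop :=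
  exists b, F b /\ gen_deriv J a b.

Definition exp_integral_over (J : R -> Prop) (F : (R -> C) -> Prop) (a : R -> C) : Prop :=
  ~ gen_zero J a /\
  exists b, F b /\ gen_deriv J a (fun x => Cmult (b x) (a x)).

Definition algebraic_over (J : R -> Prop) (F : (R -> C) -> Prop) (a : R -> C) : Prop :=
  exists l, List.Forall F l /\ List.Exists (fun c => ~ gen_zero J c) l /\
    gen_zero J (fpoly_eval l a).

Inductive liouvillian_ext (J : R -> Prop) (F : (R -> C) -> Prop) :
    ((R -> C) -> Prop) -> Prop :=
| liouv_base : liouvillian_ext J F F
| liouv_step : forall E a E',
    liouvillian_ext J F E ->
    integral_over J E a \/ exp_integral_over J E a \/ algebraic_over J E a ->
    adjoin J E a E' ->
    liouvillian_ext J F E'.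

(* y'' + kappa y = 0 *)
Definition solves_L (J : R -> Prop) (kappa y : R -> C) : Prop :=
  exists y1 y2, gen_deriv J y y1 /\ gen_deriv J y1 y2 /\
    gen_zero J (fun x => Cplus (y2 x) (Cmult (kappa x) (y x))).

(* A non-zero solution on [J] lying in a Liouvillian extension of [F]. *)
Definition liouvillian_solution (J : R -> Prop) (F : (R -> C) -> Prop)
    (kappa y : R -> C) : Prop :=
  solves_L J kappa y /\ ~ gen_zero J y /\
  exists E, liouvillian_ext J (restrict J F) E /\ E y.

(** * The first-order equation u' = phi(x,u) *)

Definition connected_fibers (D : R * R -> Prop) : Prop :=
  forall x, is_connected (fun u => D (x, u)).

Definition C2_on (D : R * R -> Prop) (phi : R -> R -> R) : Prop :=
  forall x u, D (x, u) -> ex_diff_n phi 2 x u.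

Definition curvature (phi : R -> R -> R) (x u : R) : R :=
  - (partial_derive 1 1 phi x u + (partial_derive 0 1 phi x u) ^ 2
     + phi x u * partial_derive 0 2 phi x u).

Definition ode_solution (D : R * R -> Prop) (phi : R -> R -> R)
    (J : R -> Prop) (u : R -> R) : Prop :=
  forall x, J x -> D (x, u x) /\ is_derive u x (phi x (u x)).

(* Two distinct solutions on [J] in a common Liouvillian extension of [F]. *)
Definition two_liouvillian_solutions (D : R * R -> Prop) (phi : R -> R -> R)
    (J : R -> Prop) (F : (R -> C) -> Prop) : Prop :=
  exists u1 u2, ode_solution D phi J u1 /\ ode_solution D phi J u2 /\
    (exists x, J x /\ u1 x <> u2 x) /\
    exists E, liouvillian_ext J (restrict J F) E /\
      E (fun x => RtoC (u1 x)) /\ E (fun x => RtoC (u2 x)).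

(** * Integrability by quadratures *)

(* [quadrature known U f]: on the open set [U], the real function [f] of two
   variables is obtained from the known functions by finitely many algebraic
   operations, differentiations, compositions, integrations and inversions.
   Integration is the definite integral from a constant lower limit: an arbitrary
   primitive in one variable would introduce an arbitrary function of the other. *)
Inductive quadrature (known : (R * R -> Prop) -> (R -> R -> R) -> Prop) :
    (R * R -> Prop) -> (R -> R -> R) -> Prop :=
| quad_known : forall U f, open U -> known U f -> quadrature known U f
| quad_const : forall U c, open U -> quadrature known U (fun _ _ => c)
| quad_fst : forall U, open U -> quadrature known U (fun x _ => x)
| quad_snd : forall U, open U -> quadrature known U (fun _ u => u)
| quad_restrict : forall U V f g, quadrature known U f -> open V ->
    (forall x u, V (x, u) -> U (x, u) /\ g x u = f x u) ->
    quadrature known V g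
| quad_add : forall U f g, quadrature known U f -> quadrature known U g ->
    quadrature known U (fun x u => f x u + g x u)
| quad_mul : forall U f g, quadrature known U f -> quadrature known U g ->
    quadrature known U (fun x u => f x u * g x u)
| quad_inv : forall U f, quadrature known U f ->
    (forall x u, U (x, u) -> f x u <> 0) ->
    quadrature known U (fun x u => / f x u)
| quad_deriv_fst : forall U f g, quadrature known U f ->
    (forall x u, U (x, u) -> is_derive (fun z => f z u) x (g x u)) ->
    quadrature known U g
| quad_deriv_snd : forall U f g, quadrature known U f ->
    (forall x u, U (x, u) -> is_derive (fun z => f x z) u (g x u)) ->
    quadrature known U g
| quad_comp : forall U V f g h, quadrature known V f ->
    quadrature known U g -> quadrature known U h ->
    (forall x u, U (x, u) -> V (g x u, h x u)) ->
    quadrature known U (fun x u => f (g x u) (h x u))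
| quad_int_fst : forall U V f g a, quadrature known U f -> open V ->
    (forall x u, V (x, u) ->
      (forall s, Rmin a x <= s <= Rmax a x -> U (s, u)) /\
      is_RInt (fun s => f s u) a x (g x u)) ->
    quadrature known V g
| quad_int_snd : forall U V f g a, quadrature known U f -> open V ->
    (forall x u, V (x, u) ->
      (forall s, Rmin a u <= s <= Rmax a u -> U (x, s)) /\
      is_RInt (fun s => f x s) a u (g x u)) ->
    quadrature known V g
(* The inverse of u |-> f x u, with x as a parameter. *)
| quad_inverse : forall U V f g, quadrature known U f -> open V ->
    (forall x u1 u2, U (x, u1) -> U (x, u2) -> f x u1 = f x u2 -> u1 = u2) ->
    (forall x c, V (x, c) -> U (x, g x c) /\ f x (g x c) = c) ->
    quadrature known V g.

(* M (du - phi dx) is a closed form, with M nowhere zero on [B]: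
   M_x + (phi M)_u = 0. *)
Definition integrating_factor (B : R * R -> Prop) (phi M : R -> R -> R) : Prop :=
  forall x u, B (x, u) -> M x u <> 0 /\
    exists m, is_derive (fun z => M z u) x m /\
              is_derive (fun z => phi x z * M x z) u (- m).

(* dH = M (du - phi dx) *)
Definition first_integral (B : R * R -> Prop) (phi M H : R -> R -> R) : Prop :=
  forall x u, B (x, u) ->
    is_derive (fun z => H z u) x (- (M x u * phi x u)) /\
    is_derive (fun z => H x z) u (M x u).

(* [G x c], defined for (x,c) in [W], is the general solution in [B], [c] being
   the constant of integration. *)
Definition general_solution (B : R * R -> Prop) (phi : R -> R -> R)
    (W : R * R -> Prop) (G : R -> R -> R) : Prop :=
  (forall x c, W (x, c) ->
    B (x, G x c) /\ is_derive (fun z => G z c) x (phi x (G x c))) /\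
  (forall K u, is_open_interval K -> ode_solution B phi K u ->
    exists c, forall x, K x -> W (x, c) /\ u x = G x c).

Definition box (a b c d : R) : R * R -> Prop :=
  fun p => (a < fst p < b) /\ (c < snd p < d).

(* Local integrability: boxes on which the equation is solved by quadratures are
   found arbitrarily close to every point of [D]. *)
Definition integrable_by_quadratures (D : R * R -> Prop) (phi : R -> R -> R)
    (known : (R * R -> Prop) -> (R -> R -> R) -> Prop) : Prop :=
  forall (p : R * R) (V : R * R -> Prop), D p -> locally p V ->
  exists a b c d, a < b /\ c < d /\
    (forall q, box a b c d q -> D q /\ V q) /\
    exists M H W G,
      quadrature known (box a b c d) M /\
      integrating_factor (box a b c d) phi M /\
      quadrature known (box a b c d) H /\
      first_integral (box a b c d) phi M H /\
      quadrature known W G /\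
      general_solution (box a b c d) phi W G.

(* The data: phi on [D], and the complex function [y] on [J], through its real and
   imaginary parts. *)
Inductive known_data (D : R * R -> Prop) (phi : R -> R -> R)
    (J : R -> Prop) (y : R -> C) : (R * R -> Prop) -> (R -> R -> R) -> Prop :=
| known_phi : known_data D phi J y D phi
| known_Re : known_data D phi J y (fun p => J (fst p)) (fun x _ => Re (y x))
| known_Im : known_data D phi J y (fun p => J (fst p)) (fun x _ => Im (y x)).

Definition over (J : R -> Prop) (D : R * R -> Prop) : R * R -> Prop :=
  fun p => J (fst p) /\ D p.

(** * Kovacic's algorithm *)

(* Specification of the algorithm: on input kappa = p/q it either returns a non-zero
   Liouvillian solution of y'' + kappa y = 0 over C(x) (valid on every interval), or
   reports that there is none (on any interval). *)
Definition kovacic_algorithm (A : list C -> list C -> option (R -> C)) : Prop :=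
  forall p q, nonzero_poly q ->
    match A p q with
    | Some y => forall J, is_open_interval J ->
        liouvillian_solution J Cx (ratfun p q) y
    | None => forall J y, is_open_interval J ->
        ~ liouvillian_solution J Cx (ratfun p q) y
    end.

(* The verdict [ans] of the algorithm decides the Liouvillian integrability of the
   first-order equation for x in [I]. *)
Definition decides_integrability (I : R -> Prop) (D : R * R -> Prop)
    (phi : R -> R -> R) (ans : option (R -> C)) : Prop :=
  match ans with
  | Some y => integrable_by_quadratures (over I D) phi (known_data D phi I y)
  | None => forall J, sub_interval J I -> ~ two_liouvillian_solutions D phi J Cx
  end.

(* Main.v *)
(* Along a solution u of u' = phi(x,u) one has u'' = f(x,u) with f = phi_x + phi phi_u, and
   the curvature condition says exactly that f_u = -kappa(x). Hence f is affine in u with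
   slope -kappa(x), and the difference of two solutions solves y'' + kappa y = 0.

   Conversely, let w be a real solution of the linear equation without zeros (locally, the
   real or the imaginary part of the given Liouvillian solution, which is generically
   non-zero since it lies in a field). Then M = w phi_u - w' satisfies
   M_x + (phi M)_u = 0, so it is an integrating factor wherever it does not vanish. If it
   vanishes identically on an open set, the equation is linear there,
   phi = (w'/w) u + g(x), and 1/w is an integrating factor. In both cases there is an
   explicit P with P_u = M and P_x + phi M independent of u, which gives a first integral
   H; the general solution is obtained by inverting H in u. *)

Require Import Defs.
From Stdlib Require Import Reals List Lra Classical ClassicalEpsilon Ranalysis5.
From Coquelicot Require Import Coquelicot.
Open Scope R_scope.

(** * Generic properties *)

Lemma generic_mono (J : R -> Prop) (P Q : R -> Prop) :
  (forall x, P x -> Q x) -> generic J P -> generic J Q.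
Proof.
intros PQ gP x Jx V Vx.
destruct (gP x Jx V Vx) as [z [Jz [Vz Pz]]].
exists z; repeat split; trivial.
now apply filter_imp with P.
Qed.

(** Two dense open sets meet densely: a point of [V] near which [P] holds is found first, then the
    genericity of [Q] is applied within that neighbourhood. *)
Lemma generic_and (J : R -> Prop) (P Q : R -> Prop) :
  generic J P -> generic J Q -> generic J (fun x => P x /\ Q x).
Proof.
intros gP gQ x Jx V Vx.
destruct (gP x Jx (fun z => locally z V)) as [z [Jz [Vz Pz]]].
  now apply locally_locally.
destruct (gQ z Jz (fun t => V t /\ locally t P)) as [t [Jt [[Vt Pt] Qt]]].
  apply filter_and; [exact Vz | now apply locally_locally].
exists t; repeat split; trivial.
now apply filter_and.
Qed.

Lemma generic_sub (I J : R -> Prop) (P : R -> Prop) :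
  open J -> (forall x, J x -> I x) -> generic I P -> generic J P.
Proof.
intros oJ JI gP x Jx V Vx.
destruct (gP x (JI x Jx) (fun z => V z /\ J z)) as [z [_ [[Vz Jz] Pz]]].
  apply filter_and; [exact Vx | now apply oJ].
now exists z.
Qed.

Lemma generic_all (J : R -> Prop) (P : R -> Prop) :
  open J -> (forall x, J x -> P x) -> generic J P.
Proof.
intros oJ JP x Jx V Vx.
exists x; repeat split; trivial.
  now apply locally_singleton.
apply filter_imp with J; [exact JP | now apply oJ].
Qed.

Lemma generic_exists (J : R -> Prop) (P : R -> Prop) (x : R) :
  J x -> generic J P -> forall V : R -> Prop, locally x V -> exists z, V z /\ P z.
Proof.
intros Jx gP V Vx.
destruct (gP x Jx V Vx) as [z [_ [Vz Pz]]].
exists z; split; trivial; now apply locally_singleton.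
Qed.

Lemma gen_eq_sym (J : R -> Prop) (f g : R -> C) : gen_eq J f g -> gen_eq J g f.
Proof. now apply generic_mono. Qed.

Lemma gen_eq_trans (J : R -> Prop) (f g h : R -> C) :
  gen_eq J f g -> gen_eq J g h -> gen_eq J f h.
Proof.
intros fg gh; generalize (generic_and _ _ _ fg gh).
apply generic_mono; intros x [-> ->]; trivial.
Qed.

Lemma gen_eq_sub (J : R -> Prop) (f1 f2 g1 g2 : R -> C) :
  gen_eq J f1 g1 -> gen_eq J f2 g2 ->
  gen_eq J (fun x => Cminus (f1 x) (f2 x)) (fun x => Cminus (g1 x) (g2 x)).
Proof.
intros h1 h2; generalize (generic_and _ _ _ h1 h2).
apply generic_mono; intros x [-> ->]; trivial.
Qed.

(** * Fields of functions *)

(* The only properties of differential fields that are used; they are easier to check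
   for C(x) and for restrictions than the full axioms. *)
Definition field_like (J : R -> Prop) (F : (R -> C) -> Prop) : Prop :=
  (forall f g, F f -> F g -> F (fun x => Cminus (f x) (g x))) /\
  (forall f, F f -> ~ gen_zero J f -> generic J (fun x => f x <> RtoC 0)).

Lemma diff_field_field_like (J : R -> Prop) (F : (R -> C) -> Prop) :
  diff_field J F -> field_like J F.
Proof.
intros dF; split.
  apply (df_sub _ _ dF).
intros f Ff nz; now apply (df_inv _ _ dF).
Qed.

(** The alternative between zero and generically non-zero is decided on the larger set: an element
    vanishing on [I] would vanish on [J], so it is generically non-zero on [I], hence on [J]. *)
Lemma restrict_field_like (I J : R -> Prop) (F : (R -> C) -> Prop) :
  open J -> (forall x, J x -> I x) -> field_like I F -> field_like J (restrict J F).
Proof.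
intros oJ JI [sF nF]; split.
  intros f g [f' [Ff' ff']] [g' [Fg' gg']].
  exists (fun x => Cminus (f' x) (g' x)); split; [now apply sF|].
  now apply gen_eq_sub.
intros f [g [Fg gf]] nz.
assert (nzg : generic I (fun x => g x <> RtoC 0)).
  apply nF; trivial.
  intros gz; apply nz.
  apply gen_eq_trans with g; [now apply gen_eq_sym|].
  now apply generic_sub with I.
generalize (generic_and _ _ _ gf (generic_sub _ _ _ oJ JI nzg)).
apply generic_mono; intros x [<- ]; trivial.
Qed.

(** No induction along the tower: its top is either [F] itself or the result of an [adjoin], which
    is a differential field by definition. *)
Lemma liouvillian_ext_field_like (J : R -> Prop) (F E : (R -> C) -> Prop) :
  field_like J F -> liouvillian_ext J F E -> field_like J E.
Proof.
intros fF [|E0 a E' _ _ [dE _]]; trivial.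
now apply diff_field_field_like.
Qed.

Lemma liouvillian_solution_generic_neq_0 (I J : R -> Prop) (F : (R -> C) -> Prop)
    (kappa y : R -> C) :
  open J -> (forall x, J x -> I x) -> field_like I F ->
  liouvillian_solution J F kappa y -> generic J (fun x => y x <> RtoC 0).
Proof.
intros oJ JI fF [_ [nz [E [lE Ey]]]].
eapply liouvillian_ext_field_like; eauto.
now apply restrict_field_like with I.
Qed.

Lemma solves_L_gen_eq (J : R -> Prop) (k1 k2 y : R -> C) :
  gen_eq J k1 k2 -> solves_L J k1 y -> solves_L J k2 y.
Proof.
intros k12 [y1 [y2 [d1 [d2 e]]]]; exists y1, y2; repeat split; trivial.
generalize (generic_and _ _ _ k12 e).
apply generic_mono; intros x [<- ]; trivial.
Qed.

(** * The field C(x) *)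

Lemma nonzero_poly_eval (l : list C) (z : C) :
  poly_eval l z <> RtoC 0 -> nonzero_poly l.
Proof.
unfold nonzero_poly; induction l as [|a l IH]; simpl; intros H; [now elim H|].
destruct (classic (a = RtoC 0)) as [-> | na]; [|now left].
right; apply IH; intros e; apply H; rewrite e; ring.
Qed.

(** Horner's scheme for the division by X - w; the remainder is [poly_eval l w]. *)
Fixpoint poly_quot (w : C) (l : list C) : list C :=
  match l with
  | nil => nil
  | a :: l' =>
      match l' with
      | nil => nil
      | _ => poly_eval l' w :: poly_quot w l'
      end
  end.

Lemma poly_quot_spec (w z : C) (l : list C) :
  poly_eval l z =
  Cplus (poly_eval l w) (Cmult (Cminus z w) (poly_eval (poly_quot w l) z)).
Proof.
induction l as [|a [|b l] IH].
- simpl; ring.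
- simpl; ring.
- change (poly_quot w (a :: b :: l))
    with (poly_eval (b :: l) w :: poly_quot w (b :: l)).
  remember (b :: l) as m; simpl; rewrite IH; ring.
Qed.

(** Division by X - w keeps the leading coefficient: where all higher coefficients vanish, the head
    of the quotient reduces to [b]. *)
Lemma poly_quot_nonzero (w : C) (l : list C) :
  nonzero_poly (tl l) -> nonzero_poly (poly_quot w l).
Proof.
unfold nonzero_poly.
induction l as [|a [|b l] IH]; [trivial | trivial |]; intros H.
change (poly_quot w (a :: b :: l))
  with (poly_eval (b :: l) w :: poly_quot w (b :: l)).
destruct (classic (List.Exists (fun a => a <> RtoC 0) l)) as [nl | zl].
  right; now apply IH.
left; simpl in *.
assert (e : poly_eval l w = RtoC 0).
  apply NNPP; intros ne; apply zl; now apply nonzero_poly_eval with w.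
rewrite e; replace (b + w * 0)%C with b by ring.
now inversion H.
Qed.

Lemma poly_quot_length (w : C) (l : list C) :
  length (poly_quot w l) = pred (length l).
Proof.
induction l as [|a [|b l] IH]; trivial.
change (S (length (poly_quot w (b :: l))) = length (b :: l)).
now rewrite IH.
Qed.

(** Induction on the number of coefficients: a root [w] in the interval is divided out, and the
    search continues in (w, b), where the factor X - w has no zero. *)
Lemma poly_nonvanishing_interval (l : list C) (a b : R) :
  nonzero_poly l -> a < b ->
  exists a' b', a <= a' /\ a' < b' /\ b' <= b /\
    forall x, a' < x < b' -> poly_eval l (RtoC x) <> RtoC 0.
Proof.
remember (length l) as n eqn:len.
revert l len a b; induction n as [|n IH]; intros l len a b nz ab.
  destruct l; [inversion nz | discriminate].
destruct (classic (exists w, a < w < b /\ poly_eval l (RtoC w) = RtoC 0))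
    as [[w [wab w0]] | H].
  destruct (IH (poly_quot (RtoC w) l)) with (a := w) (b := b)
      as [a' [b' [h1 [h2 [h3 h4]]]]].
  - rewrite poly_quot_length, <- len; trivial.
  - apply poly_quot_nonzero.
    (* If the tail vanished, the polynomial would be the constant [c], and the root [w] would force
       c = 0. *)
    destruct l as [|c l]; [discriminate|]; simpl.
    apply NNPP; intros zl; simpl in w0.
    assert (e : poly_eval l (RtoC w) = RtoC 0).
      apply NNPP; intros ne; apply zl; now apply nonzero_poly_eval with (RtoC w).
    rewrite e in w0; replace (c + w * 0)%C with c in w0 by ring.
    inversion nz; contradiction.
  - lra.
  - exists a', b'; repeat split; try lra.
    intros x xab; rewrite (poly_quot_spec (RtoC w)), w0, Cplus_0_l.
    apply Cmult_neq_0; [|now apply h4].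
    rewrite <- RtoC_minus; intros e; apply RtoC_inj in e; lra.
exists a, b; repeat split; try lra.
intros x xab e; apply H; now exists x.
Qed.

Lemma poly_generic_neq_0 (J : R -> Prop) (l : list C) :
  open J -> nonzero_poly l -> generic J (fun x => poly_eval l (RtoC x) <> RtoC 0).
Proof.
intros oJ nz x Jx V Vx.
assert (VJ : locally x (fun z => V z /\ J z)).
  apply filter_and; [exact Vx | now apply oJ].
destruct VJ as [eps VJ].
destruct (poly_nonvanishing_interval l x (x + eps) nz) as [a [b [h1 [h2 [h3 h4]]]]].
  generalize (cond_pos eps); lra.
destruct (VJ ((a + b) / 2)) as [Vz Jz].
  apply Rabs_def1; unfold minus, plus, opp; simpl; lra.
exists ((a + b) / 2); repeat split; trivial.
apply locally_interval with (Finite a) (Finite b); simpl; [lra | lra |].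
intros z za zb; apply h4; simpl in *; lra.
Qed.

Lemma poly_eval_plus (p q : list C) :
  exists r, forall z, poly_eval r z = Cplus (poly_eval p z) (poly_eval q z).
Proof.
revert q; induction p as [|a p IH]; intros q.
  exists q; intros z; simpl; ring.
destruct q as [|b q].
  exists (a :: p); intros z; simpl; ring.
destruct (IH q) as [r e]; exists (Cplus a b :: r); intros z; simpl.
rewrite e; ring.
Qed.

Lemma poly_eval_scal (c : C) (p : list C) :
  exists r, forall z, poly_eval r z = Cmult c (poly_eval p z).
Proof.
induction p as [|a p [r e]].
  exists nil; intros z; simpl; ring.
exists (Cmult c a :: r); intros z; simpl; rewrite e; ring.
Qed.

Lemma poly_eval_mult (p q : list C) :
  exists r, forall z, poly_eval r z = Cmult (poly_eval p z) (poly_eval q z).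
Proof.
induction p as [|a p [r e]].
  exists nil; intros z; simpl; ring.
destruct (poly_eval_scal a q) as [s es].
destruct (poly_eval_plus s (RtoC 0 :: r)) as [t et].
exists t; intros z; rewrite et, es; simpl; rewrite e; ring.
Qed.

Lemma Cx_sub (f g : R -> C) :
  Cx f -> Cx g -> Cx (fun x => Cminus (f x) (g x)).
Proof.
intros [p1 [q1 [n1 e1]]] [p2 [q2 [n2 e2]]].
destruct (poly_eval_mult q1 q2) as [q eq].
destruct (poly_eval_mult p1 q2) as [s es].
destruct (poly_eval_mult p2 q1) as [t et].
destruct (poly_eval_scal (Copp (RtoC 1)) t) as [t' et'].
destruct (poly_eval_plus s t') as [p ep].
generalize (generic_and _ _ _ (poly_generic_neq_0 _ _ open_true n1)
  (poly_generic_neq_0 _ _ open_true n2)); intros nq.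
exists p, q; split.
  (* The common denominator is a non-zero polynomial because it takes a non-zero value where neither
     factor vanishes. *)
  destruct (generic_exists _ _ 0 I nq (fun _ => True) filter_true)
    as [z [_ [nz1 nz2]]].
  apply nonzero_poly_eval with (RtoC z); rewrite eq.
  now apply Cmult_neq_0.
generalize (generic_and _ _ _ nq (generic_and _ _ _ e1 e2)).
apply generic_mono; intros x [[nz1 nz2] [<- <-]]; unfold ratfun.
rewrite ep, eq, es, et', et.
field; split; trivial.
Qed.

Lemma Cx_field_like : field_like (fun _ => True) Cx.
Proof.
split; [exact Cx_sub|].
intros f [p [q [nq e]]] nz.
assert (np : nonzero_poly p).
  apply NNPP; intros zp; apply nz.
  apply gen_eq_trans with (ratfun p q); [now apply gen_eq_sym|].
  apply generic_all; [exact open_true|]; intros x _.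
  assert (ez : poly_eval p (RtoC x) = RtoC 0).
    apply NNPP; intros ne; apply zp; now apply nonzero_poly_eval with (RtoC x).
  unfold ratfun; rewrite ez; unfold Cdiv; ring.
generalize (generic_and _ _ _ e (generic_and _ _ _
  (poly_generic_neq_0 _ _ open_true np) (poly_generic_neq_0 _ _ open_true nq))).
apply generic_mono; intros x [<- [h1 h2]].
unfold ratfun, Cdiv; apply Cmult_neq_0; trivial.
intros e0; apply C1_nz; rewrite <- (Cinv_r _ h2), e0; ring.
Qed.

(** * Derivatives through the embedding of R in C and through real and imaginary parts *)

Lemma is_derive_RtoC (f : R -> R) (x l : R) :
  is_derive f x l -> is_derive (fun t => RtoC (f t)) x (RtoC l).
Proof.
intros df.
assert (lin : is_linear (RtoC : R_NormedModule -> C_R_NormedModule)).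
  split.
  - intros a b; exact (RtoC_plus a b).
  - intros k a; apply injective_projections; [reflexivity|].
    symmetry; exact (Rmult_0_r k).
  - exists 1; split; [lra|]; intros a.
    unfold norm; simpl; unfold prod_norm, norm; simpl; unfold abs; simpl.
    rewrite Rabs_R0, Rmult_1_l.
    apply Req_le; transitivity (sqrt (Rabs a ^ 2)).
      apply (f_equal sqrt); simpl; ring.
    apply sqrt_pow2, Rabs_pos.
apply filterdiff_ext_lin with (fun y : R => RtoC (scal y l) : C_R_NormedModule).
  apply (filterdiff_comp' (U := R_NormedModule) (V := R_NormedModule)
    (W := C_R_NormedModule) f RtoC x (fun y => scal y l) RtoC df).
  now apply filterdiff_linear.
intros y; apply injective_projections; [reflexivity|].
symmetry; exact (Rmult_0_r y).
Qed.

Lemma is_derive_Re (f : R -> C) (x : R) (l : C) :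
  is_derive f x l -> is_derive (fun t => Re (f t)) x (Re l).
Proof.
intros df.
exact (filterdiff_comp' (U := R_NormedModule) (V := C_R_NormedModule)
  (W := R_NormedModule) f fst x _ fst df (filterdiff_linear _ is_linear_fst)).
Qed.

Lemma is_derive_Im (f : R -> C) (x : R) (l : C) :
  is_derive f x l -> is_derive (fun t => Im (f t)) x (Im l).
Proof.
intros df.
exact (filterdiff_comp' (U := R_NormedModule) (V := C_R_NormedModule)
  (W := R_NormedModule) f snd x _ snd df (filterdiff_linear _ is_linear_snd)).
Qed.

(** * The curvature along solutions *)

(** Chain rule for a curve. The hypotheses are asymmetric because one partial derivative existing
    nearby and continuous, with the other at the point only, already gives differentiability. *)
Lemma is_derive_along (f fx : R -> R -> R) (v : R -> R) (x fu dv : R) :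
  locally (x, v x) (fun p => is_derive (fun z => f z (snd p)) (fst p)
                               (fx (fst p) (snd p))) ->
  is_derive (fun z => f x z) (v x) fu ->
  continuity_2d_pt fx x (v x) ->
  is_derive v x dv ->
  is_derive (fun t => f t (v t)) x (fx x (v x) + fu * dv).
Proof.
intros hx hu cx hv.
replace (fx x (v x) + fu * dv) with (fx x (v x) * 1 + fu * dv) by ring.
apply is_derive_Reals, derivable_pt_lim_comp_2d with (f2 := fun t => t).
- apply filterdiff_differentiable_pt_lim.
  eapply filterdiff_ext_lin.
    apply is_derive_filterdiff with (dfx := fx); [exact hx | exact hu |].
    now apply continuity_2d_pt_filterlim.
  reflexivity.
- apply derivable_pt_lim_id.
- now apply is_derive_Reals.
Qed.

Definition dx (phi : R -> R -> R) (x u : R) : R := Derive (fun z => phi z u) x.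
Definition du (phi : R -> R -> R) (x u : R) : R := Derive (fun z => phi x z) u.

(* The second derivative, as a function of (x,u), of the solutions of u' = phi(x,u). *)
Definition accel (phi : R -> R -> R) (x u : R) : R :=
  dx phi x u + phi x u * du phi x u.

Section Curvature.

Variables (D : R * R -> Prop) (phi : R -> R -> R) (kappa : R -> R).
Hypotheses (oD : open D) (C2 : C2_on D phi).
Hypothesis curv : forall x u, D (x, u) -> curvature phi x u = kappa x.

Lemma C2_dx x u : D (x, u) -> is_derive (fun z => phi z u) x (dx phi x u).
Proof. intros Dp; destruct (C2 x u Dp) as [_ [h _]]; now apply Derive_correct. Qed.

Lemma C2_du x u : D (x, u) -> is_derive (fun z => phi x z) u (du phi x u).
Proof. intros Dp; destruct (C2 x u Dp) as [_ [_ [h _]]]; now apply Derive_correct. Qed.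

Lemma C2_dxdu x u :
  D (x, u) -> is_derive (fun z => du phi z u) x (dx (du phi) x u).
Proof.
intros Dp; destruct (C2 x u Dp) as [_ [_ [_ [_ h]]]].
now apply Derive_correct.
Qed.

Lemma C2_dudu x u :
  D (x, u) -> is_derive (fun z => du phi x z) u (du (du phi) x u).
Proof.
intros Dp; destruct (C2 x u Dp) as [_ [_ [_ [_ h]]]].
now apply Derive_correct.
Qed.

Lemma C2_dudx x u :
  D (x, u) -> is_derive (fun z => dx phi x z) u (du (dx phi) x u).
Proof.
intros Dp; destruct (C2 x u Dp) as [_ [_ [_ [h _]]]].
now apply Derive_correct.
Qed.

Lemma C2_continuity x u : D (x, u) -> continuity_2d_pt phi x u.
Proof. intros Dp; now destruct (C2 x u Dp) as [h _]. Qed.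

Lemma C2_dx_continuity x u : D (x, u) -> continuity_2d_pt (dx phi) x u.
Proof. intros Dp; now destruct (C2 x u Dp) as [_ [_ [_ [[h _] _]]]]. Qed.

Lemma C2_du_continuity x u : D (x, u) -> continuity_2d_pt (du phi) x u.
Proof. intros Dp; now destruct (C2 x u Dp) as [_ [_ [_ [_ [h _]]]]]. Qed.

Lemma C2_Schwarz x u : D (x, u) -> dx (du phi) x u = du (dx phi) x u.
Proof.
intros Dp; unfold dx, du; apply Schwarz.
- apply locally_2d_locally, filter_imp with D; [|now apply oD].
  intros [z v] Dzv; simpl; repeat split; eexists.
  + now apply C2_dx.
  + now apply C2_du.
  + now apply C2_dxdu.
  + now apply C2_dudx.
- now destruct (C2 x u Dp) as [_ [_ [_ [_ [_ [_ [_ [[h _] _]]]]]]]].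
- now destruct (C2 x u Dp) as [_ [_ [_ [[_ [_ [_ [_ [h _]]]]] _]]]].
Qed.

(** Along a solution, this is the Riccati equation v' + v^2 = - kappa for v = phi_u, whose
    linearization by v = y'/y is y'' + kappa y = 0. *)
Lemma curvature_equation x u :
  D (x, u) ->
  dx (du phi) x u + du phi x u ^ 2 + phi x u * du (du phi) x u = - kappa x.
Proof.
intros Dp; rewrite <- (curv x u Dp); unfold curvature; rewrite Ropp_involutive.
reflexivity.
Qed.

Lemma is_derive_accel x u :
  D (x, u) -> is_derive (fun z => accel phi x z) u (- kappa x).
Proof.
intros Dp.
replace (- kappa x)
  with (du (dx phi) x u + (du phi x u * du phi x u + phi x u * du (du phi) x u)).
  apply (is_derive_plus (K := R_AbsRing) (V := R_NormedModule)).
    now apply C2_dudx.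
  apply Derive.is_derive_mult; [now apply C2_du | now apply C2_dudu].
rewrite <- curvature_equation with (u := u), C2_Schwarz by trivial; ring.
Qed.

(** Mean value theorem with a constant derivative; the whole vertical segment has to lie in [D]. *)
Lemma accel_diff x u1 u2 :
  (forall u, Rmin u1 u2 <= u <= Rmax u1 u2 -> D (x, u)) ->
  accel phi x u2 - accel phi x u1 = - kappa x * (u2 - u1).
Proof.
intros Dseg.
destruct (MVT_gen (accel phi x) u1 u2 (fun _ => - kappa x)) as [c [_ e]].
- intros u hu; apply is_derive_accel, Dseg; lra.
- intros u hu; apply continuity_pt_filterlim.
  apply (ex_derive_continuous (V := R_NormedModule)); eexists.
  now apply is_derive_accel, Dseg.
- exact e.
Qed.

Lemma ode_solution_accel (J : R -> Prop) (u : R -> R) x :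
  ode_solution D phi J u -> J x ->
  is_derive (fun t => phi t (u t)) x (accel phi x (u x)).
Proof.
intros su Jx; destruct (su x Jx) as [Dx hu].
unfold accel; rewrite Rmult_comm.
apply is_derive_along with (fx := dx phi); trivial.
- apply filter_imp with D; [|now apply oD].
  intros [z v] Dzv; now apply C2_dx.
- now apply C2_du.
- now apply C2_dx_continuity.
Qed.

Lemma ode_solution_diff_solves_L (J : R -> Prop) (u1 u2 : R -> R) :
  connected_fibers D -> open J ->
  ode_solution D phi J u1 -> ode_solution D phi J u2 ->
  solves_L J (fun x => RtoC (kappa x)) (fun x => Cminus (RtoC (u1 x)) (RtoC (u2 x))).
Proof.
intros cD oJ s1 s2.
exists (fun x => RtoC (phi x (u1 x) - phi x (u2 x))),
  (fun x => RtoC (accel phi x (u1 x) - accel phi x (u2 x))).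
repeat split; apply generic_all; trivial; intros x Jx;
  destruct (s1 x Jx) as [D1 h1]; destruct (s2 x Jx) as [D2 h2].
- apply is_derive_ext with (fun t => RtoC (u1 t - u2 t)).
    intros t; apply RtoC_minus.
  apply is_derive_RtoC.
  now apply (is_derive_minus (K := R_AbsRing) (V := R_NormedModule)).
- apply is_derive_RtoC.
  apply (is_derive_minus (K := R_AbsRing) (V := R_NormedModule)
    (fun t => phi t (u1 t)) (fun t => phi t (u2 t)));
  now apply ode_solution_accel with J.
- rewrite (accel_diff x (u2 x) (u1 x)).
    rewrite <- RtoC_minus, <- RtoC_mult, <- RtoC_plus.
    apply f_equal; ring.
  (* Connectedness of the fibre places the segment between the two values in [D]. *)
  intros u; unfold Rmin, Rmax; destruct (Rle_dec (u2 x) (u1 x)); intros hu.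
    now apply (cD x (u2 x) (u1 x)).
  now apply (cD x (u1 x) (u2 x)).
Qed.

Lemma two_solutions_liouvillian (I J : R -> Prop) (F : (R -> C) -> Prop) :
  connected_fibers D -> open J -> (forall x, J x -> I x) -> field_like I F ->
  two_liouvillian_solutions D phi J F ->
  exists y, liouvillian_solution J F (fun x => RtoC (kappa x)) y.
Proof.
intros cD oJ JI fF [u1 [u2 [s1 [s2 [[x [Jx neq]] [E [lE [E1 E2]]]]]]]].
exists (fun x => Cminus (RtoC (u1 x)) (RtoC (u2 x))); split; [|split].
- now apply ode_solution_diff_solves_L.
- intros gz.
  (* By continuity the two solutions stay distinct around [x], whereas generic vanishing yields a
     nearby point where they agree. *)
  assert (cont : continuous (fun t => minus (u1 t) (u2 t)) x).
    apply (continuous_minus (V := R_NormedModule));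
      apply (ex_derive_continuous (V := R_NormedModule)); eexists;
      [exact (proj2 (s1 x Jx)) | exact (proj2 (s2 x Jx))].
  destruct (generic_exists _ _ x Jx gz (fun z => u1 z - u2 z <> 0))
    as [z [nz ez]].
    apply (cont (fun r => r <> 0)), open_neq.
    unfold minus, plus, opp; simpl; lra.
  apply nz, RtoC_inj; now rewrite RtoC_minus.
- exists E; split; trivial.
  apply (liouvillian_ext_field_like _ _ _
    (restrict_field_like _ _ _ oJ JI fF) lE); trivial.
Qed.

End Curvature.

(** * General solution from a first integral *)

Lemma continuity_pt_is_derive (f : R -> R) (x l : R) :
  is_derive f x l -> continuity_pt f x.
Proof.
intros df; apply continuity_pt_filterlim.
apply (ex_derive_continuous (V := R_NormedModule)); now exists l.
Qed.

Lemma continuity_2d_pt_snd (f : R -> R -> R) (x u : R) :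
  continuity_2d_pt f x u -> continuity_pt (f x) u.
Proof.
intros cf; apply continuity_pt_filterlim.
apply continuous_comp_2 with (f := fun _ => x) (g := fun t => t) (h := f).
- apply continuous_const.
- apply continuous_id.
- now apply continuity_2d_pt_filterlim.
Qed.

Lemma continuity_2d_pt_fst (f : R -> R -> R) (x u : R) :
  continuity_2d_pt f x u -> continuity_pt (fun t => f t u) x.
Proof.
intros cf; apply continuity_pt_filterlim.
apply continuous_comp_2 with (f := fun t => t) (g := fun _ => u) (h := f).
- apply continuous_id.
- apply continuous_const.
- now apply continuity_2d_pt_filterlim.
Qed.

Lemma mean_value (f df : R -> R) (a b : R) :
  (forall x, Rmin a b <= x <= Rmax a b -> is_derive f x (df x)) ->
  exists c, Rmin a b <= c <= Rmax a b /\ f b - f a = df c * (b - a).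
Proof.
intros hf; apply MVT_gen.
  intros x hx; apply hf; lra.
intros x hx; now apply continuity_pt_is_derive with (df x), hf.
Qed.

Lemma between_Rabs (a b t e : R) :
  Rmin a b <= t <= Rmax a b -> Rabs (b - a) < e -> Rabs (t - a) < e.
Proof.
unfold Rmin, Rmax; destruct (Rle_dec a b); unfold Rabs;
  destruct (Rcase_abs (b - a)); destruct (Rcase_abs (t - a)); lra.
Qed.

Lemma between_interval (a b c d t : R) :
  c < a < d -> c < b < d -> Rmin a b <= t <= Rmax a b -> c < t < d.
Proof. unfold Rmin, Rmax; destruct (Rle_dec a b); lra. Qed.

(** Multiplying by the constant [f v] makes the function negative at [u] and positive at [v], so one
    intermediate value argument serves both orders of signs. *)
Lemma opposite_signs_root (f : R -> R) (u v : R) :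
  (forall t, u <= t <= v -> continuity_pt f t) -> u < v -> f u * f v < 0 ->
  exists z, u <= z <= v /\ f z = 0.
Proof.
intros cf uv fuv.
assert (nv : f v <> 0) by (intros e; rewrite e in fuv; lra).
destruct (IVT_interv (fun t => f t * f v) u v) as [z [hz ez]]; trivial.
- intros t ht; apply continuity_pt_mult; [now apply cf|].
  now apply continuity_pt_const; intros ? ?.
- nra.
- exists z; split; trivial; nra.
Qed.

Lemma open_box (a b c d : R) : open (box a b c d).
Proof.
apply open_and; apply open_and.
- apply open_comp with (f := fst) (D := fun t : R => a < t).
    intros x _; apply continuous_fst.
  apply open_gt.
- apply open_comp with (f := fst) (D := fun t : R => t < b).
    intros x _; apply continuous_fst.
  apply open_lt.
- apply open_comp with (f := snd) (D := fun t : R => c < t).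
    intros x _; apply continuous_snd.
  apply open_gt.
- apply open_comp with (f := snd) (D := fun t : R => t < d).
    intros x _; apply continuous_snd.
  apply open_lt.
Qed.

Section GeneralSolution.

Variables (a b c d : R) (phi M H : R -> R -> R).
Let B := box a b c d.
Hypotheses (phiC : forall x u, B (x, u) -> continuity_2d_pt phi x u)
  (MC : forall x u, B (x, u) -> continuity_2d_pt M x u)
  (M0 : forall x u, B (x, u) -> M x u <> 0)
  (fi : first_integral B phi M H).

Lemma M_same_sign x u v : B (x, u) -> B (x, v) -> 0 < M x u * M x v.
Proof.
assert (key : forall u v, B (x, u) -> B (x, v) -> u < v -> 0 < M x u * M x v).
  intros u' v' Bu Bv uv.
  destruct (Rlt_or_le 0 (M x u' * M x v')) as [|le]; trivial.
  exfalso; destruct le as [lt|e].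
    destruct (opposite_signs_root (M x) u' v') as [z [hz ez]]; trivial.
      intros t ht; apply continuity_2d_pt_snd, MC.
      unfold B, box in *; simpl in *; lra.
    revert ez; apply M0; unfold B, box in *; simpl in *; lra.
  apply Rmult_integral in e.
  generalize (M0 _ _ Bu) (M0 _ _ Bv); tauto.
intros Bu Bv; destruct (Rtotal_order u v) as [lt | [<- | gt]].
- now apply key.
- generalize (M0 _ _ Bu); nra.
- rewrite Rmult_comm; now apply key.
Qed.

Lemma H_increment_snd x u v :
  B (x, u) -> B (x, v) ->
  exists t, Rmin u v <= t <= Rmax u v /\ B (x, t) /\
    H x v - H x u = M x t * (v - u).
Proof.
intros Bu Bv.
assert (seg : forall t, Rmin u v <= t <= Rmax u v -> B (x, t)).
  intros t ht; split; [apply Bu|].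
  now apply between_interval with u v; [apply Bu | apply Bv |].
destruct (mean_value (H x) (M x) u v) as [t [ht e]].
  intros t ht; now apply fi, seg.
exists t; auto.
Qed.

Lemma H_increment_fst x y u :
  B (x, u) -> B (y, u) ->
  exists t, Rmin x y <= t <= Rmax x y /\
    H y u - H x u = - (M t u * phi t u) * (y - x).
Proof.
intros Bx By.
destruct (mean_value (fun z => H z u) (fun z => - (M z u * phi z u)) x y)
  as [t [ht e]].
  intros t ht; apply fi; split; [|apply Bx].
  now apply between_interval with x y; [apply Bx | apply By |].
exists t; auto.
Qed.

Lemma H_injective x u v : B (x, u) -> B (x, v) -> H x u = H x v -> u = v.
Proof.
intros Bu Bv e; destruct (H_increment_snd x u v) as [t [_ [Bt et]]]; trivial.
rewrite e, Rminus_diag in et; symmetry in et; apply Rmult_integral in et.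
destruct et as [et|et]; [now elim (M0 _ _ Bt) | lra].
Qed.

(** An implicit function argument using only separate continuity of [H]. As [M] keeps its sign on
    the vertical line, [H] takes values on opposite sides of [H x0 u0] at u0 - e and u0 + e; this
    persists for (x, h) nearby, and the intermediate value theorem in [u] gives the solution. *)
Lemma H_locally_solvable x0 u0 eps :
  B (x0, u0) -> 0 < eps ->
  locally (x0, H x0 u0) (fun q => exists u,
    Rabs (u - u0) < eps /\ B (fst q, u) /\ H (fst q) u = snd q).
Proof.
intros B0 eps0.
destruct B0 as [Bx Bu] eqn:B0'; clear B0'; simpl in Bx, Bu.
(* Halving keeps the closed segment from u0 - e to u0 + e inside the box and any root in it strictly
   within [eps] of [u0]. *)
set (e := Rmin eps (Rmin (u0 - c) (d - u0)) / 2).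
assert (he : 0 < e /\ e < eps /\ c < u0 - e /\ u0 + e < d).
  unfold e, Rmin; destruct (Rle_dec (u0 - c) (d - u0));
    destruct (Rle_dec eps _); lra.
assert (B1 : forall x t, a < x < b -> u0 - e <= t <= u0 + e -> B (x, t)).
  intros x t hx ht; split; simpl; lra.
assert (neg : (H x0 (u0 - e) - H x0 u0) * (H x0 (u0 + e) - H x0 u0) < 0).
  destruct (H_increment_snd x0 u0 (u0 - e)) as [t1 [_ [Bt1 ->]]];
    [apply B1; lra | apply B1; lra |].
  destruct (H_increment_snd x0 u0 (u0 + e)) as [t2 [_ [Bt2 ->]]];
    [apply B1; lra | apply B1; lra |].
  generalize (M_same_sign _ _ _ Bt1 Bt2); intros pos.
  replace (M x0 t1 * (u0 - e - u0) * (M x0 t2 * (u0 + e - u0)))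
    with (- (M x0 t1 * M x0 t2 * (e * e))) by ring.
  assert (0 < M x0 t1 * M x0 t2 * (e * e)) by (apply Rmult_lt_0_compat; nra).
  lra.
assert (cont : forall t, u0 - e <= t <= u0 + e ->
    continuous (fun q : R * R => H (fst q) t - snd q) (x0, H x0 u0)).
  intros t ht; apply (continuous_minus (V := R_NormedModule)).
    apply (continuous_comp fst (fun z => H z t)); [apply continuous_fst|].
    apply continuity_pt_filterlim.
    exact (continuity_pt_is_derive _ _ _ (proj1 (fi _ _ (B1 _ _ Bx ht)))).
  apply continuous_snd.
assert (cont2 : continuous (fun q : R * R =>
    (H (fst q) (u0 - e) - snd q) * (H (fst q) (u0 + e) - snd q)) (x0, H x0 u0)).
  apply (continuous_mult (K := R_AbsRing)); apply cont; lra.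
assert (L1 : locally (x0, H x0 u0) (fun q : R * R =>
    (H (fst q) (u0 - e) - snd q) * (H (fst q) (u0 + e) - snd q) < 0)).
  exact (cont2 (fun r => r < 0) (open_lt 0 _ neg)).
assert (L2 : locally (x0, H x0 u0) (fun q : R * R => a < fst q < b)).
  apply (continuous_fst x0 (H x0 u0) (fun t => a < t < b)).
  apply (open_and _ _ (open_gt a) (open_lt b)); exact Bx.
generalize (filter_and _ _ L1 L2); apply filter_imp.
intros [x h]; simpl; intros [lt hx].
destruct (opposite_signs_root (fun t => H x t - h) (u0 - e) (u0 + e))
  as [z [hz ez]]; trivial; [| lra |].
  intros t ht; apply continuity_pt_minus.
    apply continuity_pt_is_derive with (M x t); now apply fi, B1.
  now apply continuity_pt_const; intros ? ?.
exists z; repeat split; simpl; try lra.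
apply Rabs_def1; lra.
Qed.

Definition level_image : R * R -> Prop :=
  fun q => exists u, B (fst q, u) /\ H (fst q) u = snd q.

(** The inverse of [H] in [u], made total by a choice operator; its values are meaningful on
    [level_image] only. *)
Definition level_curve (x h : R) : R :=
  epsilon (inhabits 0) (fun u => B (x, u) /\ H x u = h).

Lemma level_curve_spec x h :
  level_image (x, h) -> B (x, level_curve x h) /\ H x (level_curve x h) = h.
Proof. intros ex; exact (epsilon_spec (inhabits 0) (fun u => B (x, u) /\ H x u = h) ex). Qed.

Lemma level_curve_unique x u : B (x, u) -> level_curve x (H x u) = u.
Proof.
intros Bu; destruct (level_curve_spec x (H x u)) as [BG e].
  now exists u.
now apply H_injective with x.
Qed.

Lemma open_level_image : open level_image.
Proof.
intros [x h] [u [Bu e]]; simpl in *; rewrite <- e.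
generalize (H_locally_solvable x u 1 Bu Rlt_0_1); apply filter_imp.
intros q [v [_ hv]]; now exists v.
Qed.

(* If u0 and u are the values of the level curve at x and x + k, two applications of
   the mean value theorem give [M x t * (u - u0) = M s u * phi s u * k] with s, t close
   to x, u0; hence [(u - u0) / k] tends to [phi x u0]. *)
Lemma is_derive_level_curve x h :
  level_image (x, h) ->
  is_derive (fun z => level_curve z h) x (phi x (level_curve x h)).
Proof.
intros Wxh; destruct (level_curve_spec x h Wxh) as [B0 e0].
set (u0 := level_curve x h) in *.
apply is_derive_Reals; intros eps eps0.
(* The two mean value points are unrelated, so the quotient M(s,u) phi(s,u) / M(x,t) is treated as a
   function of independent variables ((s,u),t). *)
assert (cont : continuous (fun q : (R * R) * R =>
    M (fst (fst q)) (snd (fst q)) * phi (fst (fst q)) (snd (fst q))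
      * / M x (snd q)) ((x, u0), u0)).
  apply (continuous_mult (K := R_AbsRing)).
    apply (continuous_comp fst (fun p : R * R => M (fst p) (snd p) * phi (fst p) (snd p))).
      apply continuous_fst.
    apply (continuous_mult (K := R_AbsRing)); apply continuity_2d_pt_filterlim.
      now apply MC.
    now apply phiC.
  apply (continuous_comp snd (fun t => / M x t)); [apply continuous_snd|].
  apply continuity_pt_filterlim, continuity_pt_inv; [|now apply M0].
  now apply continuity_2d_pt_snd, MC.
destruct (cont (fun r => Rabs (r - phi x u0) < eps)) as [e1 near].
  exists (mkposreal eps eps0); intros r hr; simpl in hr.
  replace (phi x u0) with (M x u0 * phi x u0 * / M x u0); [exact hr|].
  field; now apply M0.
destruct (H_locally_solvable x u0 e1 B0 (cond_pos e1)) as [e2 solv].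
(* [e1] keeps the intermediate points where the quotient is close to its limit; [e2] keeps (x + k,
   h) where the level equation is solvable. *)
assert (pos : 0 < Rmin e1 e2) by (apply Rmin_pos; apply cond_pos).
exists (mkposreal _ pos); intros k nk hk; simpl in hk.
assert (hk1 : Rabs (x + k - x) < e1).
  replace (x + k - x) with k by ring; apply Rlt_le_trans with (1 := hk), Rmin_l.
assert (hk2 : Rabs (x + k - x) < e2).
  replace (x + k - x) with k by ring; apply Rlt_le_trans with (1 := hk), Rmin_r.
destruct (solv (x + k, h)) as [u [hu [Bu eu]]].
  split; simpl; [exact hk2 | rewrite e0; apply ball_center].
simpl in Bu, eu.
assert (eG : level_curve (x + k) h = u).
  rewrite <- eu; now apply level_curve_unique.
rewrite eG; fold u0.
assert (Bxu : B (x, u)) by (split; [apply B0 | apply Bu]).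
destruct (H_increment_fst x (x + k) u) as [s [hs es]]; trivial.
destruct (H_increment_snd x u0 u) as [t [ht [Bt et]]]; trivial.
replace ((u - u0) / k) with (M s u * phi s u * / M x t).
  apply (near ((s, u), t)); split; [split|]; simpl.
  - now apply between_Rabs with (x + k).
  - exact hu.
  - now apply between_Rabs with u.
assert (key : M x t * (u - u0) = M s u * phi s u * k).
  rewrite <- et; rewrite eu in es; rewrite e0.
  replace (x + k - x) with k in es by ring; lra.
replace (u - u0) with (M s u * phi s u * k / M x t).
  field; split; trivial; now apply M0.
rewrite <- key; field; now apply M0.
Qed.

(** Along a solution the derivative of [H] is M (u' - phi) = 0, and the interval [K] contains the
    segment between [x] and [y]. *)
Lemma first_integral_constant (K : R -> Prop) (u : R -> R) x y :
  is_open_interval K -> ode_solution B phi K u -> K x -> K y ->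
  H x (u x) = H y (u y).
Proof.
intros [_ [cK _]] su Kx Ky.
destruct (mean_value (fun t => H t (u t)) (fun _ => 0) x y) as [t [_ e]].
  intros t ht.
  assert (Kt : K t).
    revert ht; unfold Rmin, Rmax; destruct (Rle_dec x y); intros ht.
      now apply (cK x y).
    now apply (cK y x).
  destruct (su t Kt) as [Bt hu].
  replace 0 with (- (M t (u t) * phi t (u t)) + M t (u t) * phi t (u t)) by ring.
  apply is_derive_along with (fx := fun x u => - (M x u * phi x u)); trivial.
  - apply filter_imp with B; [|now apply open_box].
    intros [z v] Bzv; now apply fi.
  - now apply fi.
  - apply continuity_2d_pt_opp, continuity_2d_pt_mult; auto.
lra.
Qed.

Lemma general_solution_level_curve :
  general_solution B phi level_image level_curve.
Proof.
split.
  intros x h Wxh; split; [now apply level_curve_spec|].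
  now apply is_derive_level_curve.
intros K u iK su; destruct (iK) as [_ [_ [x0 Kx0]]].
(* The constant of integration is the value of [H] along the solution. *)
exists (H x0 (u x0)); intros x Kx.
rewrite <- (first_integral_constant K u x x0) by trivial.
assert (Bx : B (x, u x)) by now apply su.
split; [now exists (u x) | now rewrite level_curve_unique].
Qed.

Lemma quadrature_level_curve known :
  quadrature known B H -> quadrature known level_image level_curve.
Proof.
intros qH; apply quad_inverse with (1 := qH).
- exact open_level_image.
- exact H_injective.
- exact level_curve_spec.
Qed.

End GeneralSolution.

(** * Integration of the equation on a box *)

Definition solved_on_box (a b c d : R) (phi : R -> R -> R)
    (known : (R * R -> Prop) -> (R -> R -> R) -> Prop) : Prop :=
  exists M H W G,
    quadrature known (box a b c d) M /\
    integrating_factor (box a b c d) phi M /\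
    quadrature known (box a b c d) H /\
    first_integral (box a b c d) phi M H /\
    quadrature known W G /\
    general_solution (box a b c d) phi W G.

Lemma is_derive_eq (f : R -> R) (x l l' : R) :
  is_derive f x l -> l = l' -> is_derive f x l'.
Proof. now intros df <-. Qed.

Section Box.

Variables (a b c d : R) (phi : R -> R -> R).
Variable known : (R * R -> Prop) -> (R -> R -> R) -> Prop.
Let B := box a b c d.
Hypotheses (ab : a < b) (cd : c < d).
Hypothesis phiC : forall x u, B (x, u) -> continuity_2d_pt phi x u.
Hypothesis qphi : quadrature known B phi.

Lemma quadrature_ext U f g :
  open U -> (forall x u, U (x, u) -> g x u = f x u) ->
  quadrature known U f -> quadrature known U g.
Proof.
intros oU fg qf; apply quad_restrict with (1 := qf); trivial.
intros x u Uxu; split; auto.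
Qed.

Lemma quadrature_sub U f g :
  open U -> quadrature known U f -> quadrature known U g ->
  quadrature known U (fun x u => f x u - g x u).
Proof.
intros oU qf qg.
apply quadrature_ext with (fun x u => f x u + -1 * g x u); trivial.
  intros x u _; ring.
apply quad_add; trivial; apply quad_mul; trivial.
now apply (quad_const known U (-1)).
Qed.

(* H is the integral of [M (du - phi dx)] along a horizontal, then a vertical segment;
   since [P x u - P x u0] is the vertical part, no differentiation under the integral
   sign is needed. *)
Lemma solved_on_box_potential (M P Px : R -> R -> R) :
  quadrature known B M -> quadrature known B P ->
  (forall x u, B (x, u) -> continuity_2d_pt M x u) ->
  integrating_factor B phi M ->
  (forall x u, B (x, u) -> is_derive (fun z => P x z) u (M x u)) ->
  (forall x u, B (x, u) -> is_derive (fun z => P z u) x (Px x u)) ->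
  (forall x u v, B (x, u) -> B (x, v) ->
    Px x u + M x u * phi x u = Px x v + M x v * phi x v) ->
  solved_on_box a b c d phi known.
Proof.
intros qM qP MC iM Pu PX indep.
set (x0 := (a + b) / 2); set (u0 := (c + d) / 2).
set (f := fun t => M t u0 * phi t u0).
assert (Bu0 : forall x, a < x < b -> B (x, u0)).
  intros x hx; split; unfold u0; simpl; lra.
assert (hx0 : a < x0 < b) by (unfold x0; lra).
assert (fC : forall t, a < t < b -> continuous f t).
  intros t ht; apply (continuous_mult (K := R_AbsRing));
    apply continuity_pt_filterlim, continuity_2d_pt_fst; auto.
assert (fI : forall x, a < x < b -> is_RInt f x0 x (RInt f x0 x)).
  intros x hx; apply (RInt_correct (V := R_CompleteNormedModule)).
  apply (ex_RInt_continuous (V := R_CompleteNormedModule)); intros z hz.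
  now apply fC, between_interval with x0 x.
(* By [indep], the x-derivative of P x u - P x u0 is M phi at (x, u0) minus M phi at (x, u);
   subtracting the integral of [f] leaves - M phi. *)
set (H := fun x u => P x u - P x u0 - RInt f x0 x).
assert (fiH : first_integral B phi M H).
  intros x u Bxu; assert (hx : a < x < b) by apply Bxu.
  split.
    eapply is_derive_eq.
      apply (is_derive_minus (K := R_AbsRing) (V := R_NormedModule)).
        apply (is_derive_minus (K := R_AbsRing) (V := R_NormedModule)).
          now apply PX.
        now apply PX, Bu0.
      apply (is_derive_RInt (V := R_NormedModule)) with (a := x0); [|now apply fC].
      apply filter_imp with (fun t => a < t < b); [exact fI|].
      now apply (open_and _ _ (open_gt a) (open_lt b)).
    unfold minus, plus, opp; simpl; unfold f.
    generalize (indep x u u0 Bxu (Bu0 x hx)); lra.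
  eapply is_derive_eq.
    apply (is_derive_minus (K := R_AbsRing) (V := R_NormedModule)).
      apply (is_derive_minus (K := R_AbsRing) (V := R_NormedModule)).
        now apply Pu.
      apply (is_derive_const (K := R_AbsRing) (V := R_NormedModule)).
    apply (is_derive_const (K := R_AbsRing) (V := R_NormedModule)).
  unfold minus, plus, opp, zero; simpl; ring.
assert (oB : open B) by apply open_box.
(* Freezing the second variable is a composition with a constant function, hence stays within
   quadratures. *)
assert (at_u0 : forall g, quadrature known B g ->
    quadrature known B (fun x _ => g x u0)).
  intros g qg; apply (quad_comp known B B g (fun x _ => x) (fun _ _ => u0)); trivial.
  - now apply quad_fst.
  - now apply quad_const.
  - intros x u Bxu; apply Bu0, Bxu.
assert (qH : quadrature known B H).
  apply quadrature_sub; trivial.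
    apply quadrature_sub; auto.
  apply quad_int_fst with (U := B) (f := fun x _ => f x) (a := x0); trivial.
    apply quad_mul; auto.
  intros x u Bxu; split; [|apply fI, Bxu].
  intros s hs; split; [|apply Bxu].
  apply between_interval with x0 x; trivial; apply Bxu.
assert (M0 : forall x u, B (x, u) -> M x u <> 0) by (intros x u Bxu; now apply iM).
exists M, H, (level_image a b c d H), (level_curve a b c d H).
repeat (split; [assumption|]); split.
  now apply quadrature_level_curve with phi M.
now apply general_solution_level_curve with M.
Qed.

End Box.

(** * Integrating factors built from a real solution [w] of the linear equation *)

Section Integration.

Variables (D : R * R -> Prop) (phi : R -> R -> R) (kappa : R -> R).
Variables (known : (R * R -> Prop) -> (R -> R -> R) -> Prop) (w w1 : R -> R).
Variables (a b c d : R).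
Let B := box a b c d.
Hypotheses (oD : open D) (C2 : C2_on D phi).
Hypothesis curv : forall x u, D (x, u) -> curvature phi x u = kappa x.
Hypotheses (ab : a < b) (cd : c < d) (BD : forall p, B p -> D p).
Hypotheses (dw : forall x, a < x < b -> is_derive w x (w1 x))
  (dw1 : forall x, a < x < b -> is_derive w1 x (- kappa x * w x))
  (w0 : forall x, a < x < b -> w x <> 0).
Hypotheses (qphi : quadrature known B phi) (qw : quadrature known B (fun x _ => w x)).

Let qw1 : quadrature known B (fun x _ => w1 x).
Proof. apply quad_deriv_fst with (1 := qw); intros x u Bxu; apply dw, Bxu. Qed.

Let cw x u : B (x, u) -> continuity_2d_pt (fun x _ => w x) x u.
Proof.
intros [hx _]; apply (continuity_1d_2d_pt_comp w (fun x _ => x)).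
  now apply continuity_pt_is_derive with (w1 x), dw.
apply continuity_2d_pt_id1.
Qed.

(* The derivative of [w phi_u - w'] along solutions is [- phi_u (w phi_u - w')]
   by the Riccati equation satisfied by [phi_u] along them. *)
Lemma solved_on_box_nondegenerate :
  (forall x u, B (x, u) -> w x * du phi x u - w1 x <> 0) ->
  solved_on_box a b c d phi known.
Proof.
intros N0.
assert (oB : open B) by apply open_box.
assert (qdu : quadrature known B (du phi)).
  apply quad_deriv_snd with (1 := qphi); intros x u Bxu.
  now apply C2_du with D; auto.
apply solved_on_box_potential with
  (* Here Px + M phi = w (accel + kappa u), which does not depend on [u] since [accel] is affine in
     [u] with slope - kappa. *)
  (M := fun x u => w x * du phi x u - w1 x)
  (P := fun x u => w x * phi x u - w1 x * u)
  (Px := fun x u => w1 x * phi x u + w x * dx phi x u + kappa x * w x * u); trivial.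
- intros x u Bxu; now apply C2_continuity with D; auto.
- apply quadrature_sub; trivial.
  apply (quad_mul known B (fun x _ => w x)); trivial.
- apply quadrature_sub; trivial.
    apply (quad_mul known B (fun x _ => w x)); trivial.
  apply (quad_mul known B (fun x _ => w1 x)); trivial.
  now apply quad_snd.
- intros x u Bxu; apply continuity_2d_pt_minus.
    apply continuity_2d_pt_mult; [now apply cw|].
    now apply C2_du_continuity with D; auto.
  apply (continuity_1d_2d_pt_comp w1 (fun x _ => x)).
    apply continuity_pt_is_derive with (- kappa x * w x), dw1, Bxu.
  apply continuity_2d_pt_id1.
- intros x u Bxu; split; [now apply N0|].
  assert (hx : a < x < b) by apply Bxu.
  (* This is M_x with w'' replaced by - kappa w; adding (phi M)_u gives [w] times the curvature
     equation, that is 0. *)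
  exists (w1 x * du phi x u + w x * dx (du phi) x u + kappa x * w x); split.
    eapply is_derive_eq.
      apply (is_derive_minus (K := R_AbsRing) (V := R_NormedModule)).
        apply Derive.is_derive_mult; [now apply dw|].
        now apply C2_dxdu with D; auto.
      now apply dw1.
    unfold minus, plus, opp; simpl; ring.
  eapply is_derive_eq.
    apply Derive.is_derive_mult.
      now apply C2_du with D; auto.
    apply (is_derive_minus (K := R_AbsRing) (V := R_NormedModule)).
      apply is_derive_scal.
      now apply C2_dudu with D; auto.
    apply (is_derive_const (K := R_AbsRing) (V := R_NormedModule)).
  generalize (curvature_equation _ _ _ curv _ _ (BD _ Bxu)); intros e.
  unfold minus, plus, opp, zero, scal; simpl; unfold mult; simpl.
  replace (kappa x) with (- - kappa x) by ring; rewrite <- e; ring.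
- intros x u Bxu.
  apply (is_derive_minus (K := R_AbsRing) (V := R_NormedModule)).
    apply is_derive_scal.
    now apply C2_du with D; auto.
  eapply is_derive_eq.
    apply is_derive_scal.
    apply (is_derive_id (K := R_AbsRing)).
  unfold scal, one; simpl; unfold mult; simpl; ring.
- intros x u Bxu; assert (hx : a < x < b) by apply Bxu.
  eapply is_derive_eq.
    apply (is_derive_minus (K := R_AbsRing) (V := R_NormedModule)).
      apply Derive.is_derive_mult; [now apply dw|].
      now apply C2_dx with D; auto.
    apply Derive.is_derive_mult; [now apply dw1|].
    apply (is_derive_const (K := R_AbsRing) (V := R_NormedModule)).
  unfold minus, plus, opp, zero; simpl; ring.
- intros x u v Bxu Bxv.
  assert (e : accel phi x u - accel phi x v = - kappa x * (u - v)).
    apply accel_diff with D; trivial.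
    intros t ht; apply BD; split; [apply Bxu|].
    apply between_interval with v u; [apply Bxv | apply Bxu | exact ht].
  unfold accel in e.
  apply Rminus_diag_uniq; rewrite <- (Rmult_0_r (w x)).
  rewrite <- (Rminus_diag (- kappa x * (u - v))), <- e at 1; ring.
Qed.

(* In this case the equation is linear: [phi = (w'/w) u + g]. *)
Lemma solved_on_box_linear :
  (forall x u, B (x, u) -> w x * du phi x u - w1 x = 0) ->
  solved_on_box a b c d phi known.
Proof.
intros N0.
assert (oB : open B) by apply open_box.
assert (qM : quadrature known B (fun x _ => / w x)).
  apply (quad_inv known B (fun x _ => w x)); trivial.
  intros x u Bxu; apply w0, Bxu.
assert (duE : forall x u, B (x, u) -> du phi x u = w1 x / w x).
  intros x u Bxu; generalize (N0 x u Bxu) (w0 x (proj1 Bxu)); intros e nz.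
  field_simplify_eq; lra.
assert (dinv : forall x, a < x < b ->
    is_derive (fun z => / w z) x (- w1 x / w x ^ 2)).
  intros x hx; apply is_derive_inv; auto.
apply solved_on_box_potential with
  (* Now Px + M phi = (phi - (w'/w) u) / w, independent of [u] because phi_u = w'/w on the box. *)
  (M := fun x _ => / w x) (P := fun x u => / w x * u)
  (Px := fun x u => - w1 x / w x ^ 2 * u); trivial.
- intros x u Bxu; now apply C2_continuity with D; auto.
- apply (quad_mul known B (fun x _ => / w x)); trivial; now apply quad_snd.
- intros x u Bxu; apply continuity_2d_pt_inv; [now apply cw | apply w0, Bxu].
- intros x u Bxu; assert (hx : a < x < b) by apply Bxu.
  split; [now apply Rinv_neq_0_compat, w0|].
  exists (- w1 x / w x ^ 2); split; [now apply dinv|].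
  eapply is_derive_eq.
    apply Derive.is_derive_mult.
      now apply C2_du with D; auto.
    apply (is_derive_const (K := R_AbsRing) (V := R_NormedModule)).
  unfold zero; simpl; rewrite duE by trivial; field; now apply w0.
- intros x u Bxu; eapply is_derive_eq.
    apply is_derive_scal.
    apply (is_derive_id (K := R_AbsRing)).
  unfold scal, one; simpl; unfold mult; simpl; ring.
- intros x u Bxu; assert (hx : a < x < b) by apply Bxu.
  eapply is_derive_eq.
    apply Derive.is_derive_mult; [now apply dinv|].
    apply (is_derive_const (K := R_AbsRing) (V := R_NormedModule)).
  unfold zero; simpl; ring.
- intros x u v Bxu Bxv.
  destruct (mean_value (phi x) (fun _ => w1 x / w x) v u) as [t [_ e]].
    intros t ht.
    assert (Bxt : B (x, t)).
      split; [apply Bxu|].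
      apply between_interval with v u; [apply Bxv | apply Bxu | exact ht].
    rewrite <- (duE x t Bxt); now apply C2_du with D; auto.
  replace (phi x u) with (phi x v + w1 x / w x * (u - v)) by lra.
  field; apply w0, Bxu.
Qed.

End Integration.

(** Either w phi_u - w' is non-zero at some point, hence by continuity on a smaller box around it,
    or it vanishes on the whole box and no shrinking is required. *)
Lemma solved_on_subbox (D : R * R -> Prop) (phi : R -> R -> R) (kappa : R -> R)
    (known : (R * R -> Prop) -> (R -> R -> R) -> Prop) (w w1 : R -> R) (a b c d : R) :
  open D -> C2_on D phi ->
  (forall x u, D (x, u) -> curvature phi x u = kappa x) ->
  a < b -> c < d -> (forall p, box a b c d p -> D p) ->
  (forall x, a < x < b -> is_derive w x (w1 x) /\
     is_derive w1 x (- kappa x * w x) /\ w x <> 0) ->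
  quadrature known (box a b c d) phi ->
  quadrature known (box a b c d) (fun x _ => w x) ->
  exists a' b' c' d', a' < b' /\ c' < d' /\
    (forall p, box a' b' c' d' p -> box a b c d p) /\
    solved_on_box a' b' c' d' phi known.
Proof.
intros oD C2 curv ab cd BD hw qphi qw.
destruct (classic (exists x u, box a b c d (x, u) /\ w x * du phi x u - w1 x <> 0))
    as [[x [u [Bxu N0]]] | lin].
  assert (hx : a < x < b) by apply Bxu.
  assert (cN : continuity_2d_pt (fun x u => w x * du phi x u - w1 x) x u).
    apply continuity_2d_pt_minus; [apply continuity_2d_pt_mult|].
    - apply (continuity_1d_2d_pt_comp w (fun x _ => x)).
        now apply continuity_pt_is_derive with (w1 x), hw.
      apply continuity_2d_pt_id1.
    - apply C2_du_continuity with D; auto.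
    - apply (continuity_1d_2d_pt_comp w1 (fun x _ => x)).
        now apply continuity_pt_is_derive with (- kappa x * w x), hw.
      apply continuity_2d_pt_id1.
  assert (near := continuity_2d_pt_neq_0 _ _ _ cN N0).
  apply locally_2d_locally in near.
  destruct (filter_and _ _ near (open_box a b c d _ Bxu)) as [e he].
  generalize (cond_pos e); intros epos.
  assert (sub : forall p, box (x - e) (x + e) (u - e) (u + e) p ->
      w (fst p) * du phi (fst p) (snd p) - w1 (fst p) <> 0 /\ box a b c d p).
    intros [z v] [hz hv]; apply he; split; simpl in *; apply Rabs_def1;
      unfold minus, plus, opp; simpl; lra.
  assert (subx : forall z, x - e < z < x + e -> a < z < b).
    intros z hz; apply (sub (z, u)); split; simpl; lra.
  exists (x - e), (x + e), (u - e), (u + e).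
  split; [lra|]; split; [lra|]; split; [intros p Bp; now apply sub|].
  apply solved_on_box_nondegenerate with D kappa w w1; trivial.
  - lra.
  - lra.
  - intros p Bp; now apply BD, sub.
  - intros z hz; now apply hw, subx.
  - intros z hz; now apply hw, subx.
  - apply quad_restrict with (1 := qphi); [apply open_box|].
    intros z v Bzv; split; [now apply sub | trivial].
  - apply quad_restrict with (1 := qw); [apply open_box|].
    intros z v Bzv; split; [now apply sub | trivial].
  - intros z v Bzv; now apply (sub (z, v)).
exists a, b, c, d; split; [trivial|]; split; [trivial|]; split; [trivial|].
apply solved_on_box_linear with D w w1; trivial.
- intros x hx; now apply hw.
- intros x hx; now apply hw.
- intros x u Bxu; apply NNPP; intros N0; apply lin; now exists x, u.
Qed.

(** * Real solutions of the linear equation *)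

(** As [kappa] is real, the real and imaginary parts of [y] satisfy the same equation. At a generic
    point [z] close to [x] one of them is non-zero, and it remains so nearby. *)
Lemma real_solution_near (J : R -> Prop) (kappa : R -> R) (y : R -> C)
    (x : R) (V : R -> Prop) :
  open J -> J x -> locally x V ->
  solves_L J (fun x => RtoC (kappa x)) y -> generic J (fun x => y x <> RtoC 0) ->
  exists z w w1, V z /\ J z /\ (w = (fun t => Re (y t)) \/ w = (fun t => Im (y t))) /\
    locally z (fun t => is_derive w t (w1 t) /\
      is_derive w1 t (- kappa t * w t) /\ w t <> 0).
Proof.
intros oJ Jx Vx [y1 [y2 [d1 [d2 e]]]] nz.
destruct (generic_and _ _ _ nz (generic_and _ _ _ d1 (generic_and _ _ _ d2 e))
  x Jx V Vx) as [z [Jz [Vz Lz]]].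
assert (nzz := proj1 (locally_singleton _ _ Lz)); simpl in nzz.
assert (proj : exists pr : C -> R, (pr = Re \/ pr = Im) /\ pr (y z) <> 0).
  destruct (Req_dec (Re (y z)) 0) as [r0|]; [|now exists Re; auto].
  destruct (Req_dec (Im (y z)) 0) as [i0|]; [|now exists Im; auto].
  exfalso; apply nzz; now apply injective_projections.
destruct proj as [pr [hpr prz]].
assert (L : locally z (fun t => is_derive (fun s => pr (y s)) t (pr (y1 t)) /\
    is_derive (fun s => pr (y1 s)) t (- kappa t * pr (y t)))).
  apply filter_imp with (2 := Lz); intros t [_ [h1 [h2 e2]]].
  assert (e3 : pr (y2 t) = - kappa t * pr (y t)).
    destruct hpr as [-> | ->].
    - apply (f_equal fst) in e2; simpl in e2; unfold Re; lra.
    - apply (f_equal snd) in e2; simpl in e2; unfold Im; lra.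
  rewrite <- e3.
  destruct hpr as [-> | ->]; split.
  - now apply is_derive_Re.
  - now apply is_derive_Re.
  - now apply is_derive_Im.
  - now apply is_derive_Im.
exists z, (fun t => pr (y t)), (fun t => pr (y1 t)).
repeat (split; [trivial; destruct hpr as [-> | ->]; auto|]).
assert (near : locally z (fun t => pr (y t) <> 0)).
  assert (ct : continuous (fun t => pr (y t)) z).
    apply continuity_pt_filterlim, continuity_pt_is_derive with (pr (y1 z)).
    exact (proj1 (locally_singleton _ _ L)).
  now apply (ct (fun r => r <> 0)), open_neq.
generalize (filter_and _ _ L near); apply filter_imp; tauto.
Qed.

(** The box need not contain the given point (x, u): it is sought inside a box centred at (z, u),
    with [z] close to [x] and a zero-free real solution available around [z]. *)
Lemma integrable_by_quadratures_of_solution (D : R * R -> Prop) (phi : R -> R -> R)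
    (J : R -> Prop) (kappa : R -> R) (y : R -> C) :
  open D -> C2_on D phi ->
  (forall x u, D (x, u) -> curvature phi x u = kappa x) -> open J ->
  solves_L J (fun x => RtoC (kappa x)) y -> generic J (fun x => y x <> RtoC 0) ->
  integrable_by_quadratures (over J D) phi (known_data D phi J y).
Proof.
intros oD C2 curv oJ sy nz [x u] V [Jx Dxu] Vp; simpl in Jx.
assert (oJ2 : open (fun p : R * R => J (fst p))).
  apply open_comp with (f := fst) (D := J); trivial.
  intros p _; apply continuous_fst.
destruct (filter_and _ _ Vp (filter_and _ _ (oJ2 (x, u) Jx) (oD _ Dxu))) as [e he].
generalize (cond_pos e); intros epos.
destruct (real_solution_near J kappa y x (fun z => x - e < z < x + e))
  as [z [w [w1 [hz [Jz [hw Lz]]]]]]; trivial.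
  apply (open_and _ _ (open_gt (x - e)) (open_lt (x + e))); lra.
assert (Iz : locally z (fun t => x - e < t < x + e)).
  apply (open_and _ _ (open_gt (x - e)) (open_lt (x + e))); lra.
destruct (filter_and _ _ Lz Iz) as [r hr].
generalize (cond_pos r); intros rpos.
assert (hr' : forall t, z - r < t < z + r -> (is_derive w t (w1 t) /\
    is_derive w1 t (- kappa t * w t) /\ w t <> 0) /\ x - e < t < x + e).
  intros t ht; apply hr, Rabs_def1; unfold minus, plus, opp; simpl; lra.
assert (sub : forall p, box (z - r) (z + r) (u - e) (u + e) p ->
    V p /\ J (fst p) /\ D p).
  intros [t v] [ht hv]; simpl in ht, hv; apply he.
  destruct (hr' t ht) as [_ ht'].
  split; apply Rabs_def1; unfold minus, plus, opp; simpl; lra.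
destruct (solved_on_subbox D phi kappa (known_data D phi J y) w w1
  (z - r) (z + r) (u - e) (u + e)) as [a [b [c [d [ab [cd [sub2 sol]]]]]]]; trivial.
- lra.
- lra.
- intros p Bp; now apply sub.
- intros t ht; now apply hr'.
- apply quad_restrict with (U := D) (f := phi).
  + apply quad_known; [exact oD | constructor].
  + apply open_box.
  + intros t v Btv; split; [now apply sub | trivial].
- apply quad_restrict with (U := fun p => J (fst p)) (f := fun t _ => w t).
  + apply quad_known; [exact oJ2 |].
    destruct hw as [-> | ->]; constructor.
  + apply open_box.
  + intros t v Btv; split; [now apply (sub (t, v)) | trivial].
- exists a, b, c, d; split; [trivial|]; split; [trivial|]; split; [|exact sol].
  intros p Bp; destruct (sub p (sub2 p Bp)) as [Vp' [Jp Dp]].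
  now repeat split.
Qed.

(** * The two implications and the verdict of the algorithm *)

Theorem theorem7p1 :
  forall (D : R * R -> Prop) (phi : R -> R -> R) (I : R -> Prop) (kappa : R -> R),
    open D -> connected_fibers D -> C2_on D phi -> is_open_interval I ->
    (forall x u, D (x, u) -> curvature phi x u = kappa x) ->
    (forall F : (R -> C) -> Prop,
       diff_field I F -> alg_closed_constants I F ->
       F (fun x => RtoC (kappa x)) ->
       (forall (J : R -> Prop) (y : R -> C), sub_interval J I ->
          liouvillian_solution J F (fun x => RtoC (kappa x)) y ->
          integrable_by_quadratures (over J D) phi (known_data D phi J y))
       /\
       (forall J : R -> Prop, sub_interval J I ->
          two_liouvillian_solutions D phi J F ->
          exists y : R -> C,
            liouvillian_solution J F (fun x => RtoC (kappa x)) y))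
    /\
    (forall (A : list C -> list C -> option (R -> C)) (p q : list C),
       kovacic_algorithm A -> nonzero_poly q ->
       gen_eq I (fun x => RtoC (kappa x)) (ratfun p q) ->
       decides_integrability I D phi (A p q)).
Proof.
intros D phi I kappa oD cD C2 iI curv.
split.
- intros F dF _ _; split.
  + intros J y [[oJ _] JI] ly.
    apply integrable_by_quadratures_of_solution with kappa; trivial.
      apply ly.
    apply liouvillian_solution_generic_neq_0 with (4 := ly) (I := I); trivial.
    now apply diff_field_field_like.
  + intros J [[oJ _] JI]; apply two_solutions_liouvillian with I; trivial.
    now apply diff_field_field_like.
- intros A p q kov nq eq; unfold decides_integrability.
  specialize (kov p q nq); destruct (A p q) as [y|].
  + assert (ly := kov I iI); destruct iI as [oI _].
    apply integrable_by_quadratures_of_solution with kappa; trivial.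
      (* The algorithm speaks of p/q, which agrees with [kappa] only generically on [I]; [solves_L]
         is insensitive to the difference. *)
      apply solves_L_gen_eq with (ratfun p q); [now apply gen_eq_sym | apply ly].
    now apply liouvillian_solution_generic_neq_0
      with (4 := ly) (I := fun _ => True), Cx_field_like.
  + intros J [iJ JI] two.
    (* The elements of [Cx] are functions on R, so the restriction to [J] is made from the whole
       line. *)
    destruct (two_solutions_liouvillian D phi kappa oD C2 curv (fun _ => True) J Cx)
      as [y [sy rest]]; trivial.
    * apply iJ.
    * exact Cx_field_like.
    (* The difference of the two solutions would be a Liouvillian solution on [J], which the
       negative verdict excludes. *)
    * apply (kov J y iJ); split; trivial.
      apply solves_L_gen_eq with (2 := sy).
      apply generic_sub with I; trivial; apply iJ.
Qed.
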